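(* The generating function of the classical Euler numbers $E_n$ has the continued fraction expansion $$\sum_{n=0}^\infty E_n\frac{x^n}{n!}=\frac{1}{\cosh x}=1-\cfrac{x^2}{1\cdot 2+x^2-\cfrac{1\cdot 2\,x^2}{3\cdot 4+x^2-\cfrac{3\cdot 4\,x^2}{5\cdot 6+x^2-\ddots}}}\,,$$ i.e. the continued fraction $a_0+\cfrac{b_1}{a_1+\cfrac{b_2}{a_2+\ddots}}$ with $a_0=1$, $b_1=-x^2$, $a_n=(2n-1)(2n)+x^2$ for $n\ge 1$, and $b_n=-(2n-3)(2n-2)x^2$ for $n\ge 2$.
   Context: The classical Euler numbers $E_n$ are defined by $\frac{1}{\cosh x}=\sum_{n=0}^\infty E_n\frac{x^n}{n!}$. Convention on continued fractions: for polynomials $a_n$ ($n\ge 0$), $b_n$ ($n\ge 1$) in $x$, the convergents $P_n/Q_n$ of $a_0+\cfrac{b_1}{a_1+\cfrac{b_2}{a_2+\ddots}}$ are defined by $P_{-1}=1$, $Q_{-1}=0$, $P_0=a_0$, $Q_0=1$, $P_n=a_nP_{n-1}+b_nP_{n-2}$, $Q_n=a_nQ_{n-1}+b_nQ_{n-2}$ ($n\ge 1$). A formal power series $f(x)$ has this continued fraction expansion (written as an equality) if for every $n\ge 0$ the power series expansion at $x=0$ of $P_n(x)/Q_n(x)$ agrees with $f(x)$ up to and including the term in $x^n$, i.e. $P_n/Q_n\equiv f\pmod{x^{n+1}}$; in particular $f=\lim_{n\to\infty}P_n/Q_n$ as formal power series. *)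

(* Defs.v *)
From mathcomp Require Import all_boot all_order all_algebra.

Set Implicit Arguments.
Unset Strict Implicit.
Unset Printing Implicit Defensive.

Import Order.TTheory GRing.Theory Num.Theory.
Local Open Scope ring_scope.

(* [f : fps R] stands for the formal power series \sum_n f n * x^n; equality   *)
(* of series is pointwise equality [=1] of the coefficient sequences.         *)
Definition fps (R : Type) := nat -> R.

Section FormalPowerSeries.
Variable R : fieldType.
Implicit Types f g : fps R.

Definition fps_one : fps R := fun n => (n == 0%N)%:R.

Definition fps_mul f g : fps R := fun n => \sum_(i < n.+1) f i * g (n - i)%N.

Definition fps_of_poly (p : {poly R}) : fps R := fun n => p`_n.

(* The coefficients g_0, ..., g_n of 1/f, computed from g_0 = 1/f_0 and       *)
(* g_m = - f_0^-1 * \sum_(i < m) g_i * f_(m - i).                             *)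
Fixpoint fps_inv_seq f (n : nat) : seq R :=
  if n is m.+1 then
    let s := fps_inv_seq f m in
    rcons s (- (f 0%N)^-1 * \sum_(i < m.+1) s`_i * f (m.+1 - i)%N)
  else [:: (f 0%N)^-1].

(* Meaningful only when f 0 != 0, see [fps_mulVf].                            *)
Definition fps_inv f : fps R := fun n => (fps_inv_seq f n)`_n.

Lemma size_fps_inv_seq f n : size (fps_inv_seq f n) = n.+1.
Proof. by elim: n => //= n IHn; rewrite size_rcons IHn. Qed.

Lemma nth_fps_inv_seq f n i :
  (i <= n)%N -> (fps_inv_seq f n)`_i = fps_inv f i.
Proof.
elim: n => [|n IHn]; first by case: i.
rewrite leq_eqVlt => /predU1P[->//|]; rewrite ltnS => le_in.
by rewrite /= nth_rcons size_fps_inv_seq ltnS le_in IHn.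
Qed.

Lemma fps_mulVf f : f 0%N != 0 -> fps_mul (fps_inv f) f =1 fps_one.
Proof.
move=> f0 [|n]; rewrite /fps_mul big_ord_recr /= subnn.
  by rewrite big_ord0 add0r /fps_inv /= mulVf.
rewrite {2}/fps_inv /= nth_rcons size_fps_inv_seq ltnn eqxx.
rewrite mulrAC mulNr mulVf // mulN1r /fps_one /=.
apply/eqP; rewrite subr_eq0; apply/eqP; apply: eq_bigr => i _.
by rewrite nth_fps_inv_seq // -ltnS.
Qed.

(* [g] is the power series expansion at x = 0 of the rational function p / q. *)
Definition ratfun_expansion (p q : {poly R}) (g : fps R) : Prop :=
  q != 0 /\ fps_mul (fps_of_poly q) g =1 fps_of_poly p.

Definition fps_eqmod (m : nat) f g : Prop := forall k, (k < m)%N -> f k = g k.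

End FormalPowerSeries.

Section ContinuedFraction.
Variables (R : fieldType) (a b : nat -> {poly R}).

(* (X_(n-1), X_n) for X_n = a_n X_(n-1) + b_n X_(n-2), given (X_(-1), X_0);   *)
(* the value b 0 is never used.                                               *)
Fixpoint cf_rec (init : {poly R} * {poly R}) (n : nat) : {poly R} * {poly R} :=
  if n is m.+1 then
    let: (y, x) := cf_rec init m in (x, a m.+1 * x + b m.+1 * y)
  else init.

Definition cf_num (n : nat) : {poly R} := (cf_rec (1, a 0%N) n).2.
Definition cf_den (n : nat) : {poly R} := (cf_rec (0, 1) n).2.

Definition has_cf_expansion (f : fps R) : Prop :=
  forall n : nat, exists2 g : fps R,
    ratfun_expansion (cf_num n) (cf_den n) g & fps_eqmod n.+1 g f.

End ContinuedFraction.

(* cosh x = (e^x + e^(-x)) / 2                                                *)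
Definition fps_cosh : fps rat :=
  fun n => ((n`!%:R)^-1 + (-1) ^+ n / n`!%:R) / 2.

Lemma fps_cosh0 : fps_cosh 0 != 0.
Proof. by []. Qed.

Definition euler_number (n : nat) : rat := n`!%:R * fps_inv fps_cosh n.

(* Exponential generating function \sum_n E_n x^n / n!                        *)
Definition egf (E : nat -> rat) : fps rat := fun n => E n / n`!%:R.

Definition sech_a (n : nat) : {poly rat} :=
  if n == 0%N then 1 else ((2 * n - 1) * (2 * n))%N%:R%:P + 'X^2.

Definition sech_b (n : nat) : {poly rat} :=
  if n == 1%N then - 'X^2 else - (((2 * n - 3) * (2 * n - 2))%N%:R *: 'X^2).

(* Main.v *)
(* The convergents are P_n = (2n)! and Q_n = (2n)! C_n, where C_n is the Taylor *)
(* polynomial of degree 2n of cosh; so P_n / Q_n = 1 / C_n, which agrees with  *)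
(* 1 / cosh up to degree 2n + 1.                                               *)
Require Import Defs.
From mathcomp Require Import all_boot all_order all_algebra.
From mathcomp Require Import ring zify.

Set Implicit Arguments.
Unset Strict Implicit.

Import GRing.Theory Num.Theory.
Local Open Scope ring_scope.

(** Put c_n = (2n-1)(2n), so that a_n = c_n + x^2 and, for n >= 2, b_n = -c_(n-1) x^2. The
    recurrence then reads X_n = c_n X_(n-1) + x^2 (X_(n-1) - c_(n-1) X_(n-2)). For P_n = (2n)! the
    bracket vanishes; for Q_n = (2n)! C_n it is x^(2n-2), so each step adds x^(2n), the new Taylor
    term of cosh ([sech_cf_num], [sech_cf_den]). Agreement of C_n with cosh passes to the inverses
    by [fps_inv_eqmod]. *)

Section PowerSeries.
Variable R : fieldType.
Implicit Types f g : fps R.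

Lemma fps_mulC f g : fps_mul f g =1 fps_mul g f.
Proof.
move=> n; rewrite /fps_mul (reindex_inj rev_ord_inj) /=.
apply: eq_bigr => i _; rewrite subSS mulrC; congr (g _ * _).
by rewrite subKn // -ltnS.
Qed.

Lemma fps_mul_polyZ c (p : {poly R}) f n :
  fps_mul (fps_of_poly (c *: p)) f n = c * fps_mul (fps_of_poly p) f n.
Proof.
rewrite /fps_mul big_distrr; apply: eq_bigr => i _ /=.
by rewrite /fps_of_poly coefZ mulrA.
Qed.

(** Coefficient k of the inverse is computed from coefficients 0 to k only. The induction compares
    whole lists, as each new entry uses all earlier ones. *)
Lemma fps_inv_eqmod m f g :
  fps_eqmod m f g -> fps_eqmod m (fps_inv f) (fps_inv g).
Proof.
move=> efg k lt_km; rewrite /fps_inv; congr nth.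
elim: k lt_km => [|k IHk] lt_km /=; first by rewrite efg.
rewrite (IHk (ltnW lt_km)) efg ?(leq_ltn_trans _ lt_km) //; congr (rcons _ (_ * _)).
by apply: eq_bigr => i _; rewrite efg // (leq_ltn_trans _ lt_km) ?leq_subr.
Qed.

End PowerSeries.

Lemma cf_recS (R : fieldType) (a b : nat -> {poly R}) init n y x :
  cf_rec a b init n = (y, x) ->
  cf_rec a b init n.+1 = (x, a n.+1 * x + b n.+1 * y).
Proof. by move=> /= ->. Qed.

Lemma fps_cosh_odd n : fps_cosh (2 * n).+1 = 0.
Proof.
by rewrite /fps_cosh exprS exprM sqrrN !expr1n mulr1 mulN1r subrr mul0r.
Qed.

Lemma fps_cosh_even n : fps_cosh (2 * n)%N = (2 * n)`!%:R^-1.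
Proof.
have /negPf nz : (2 * n)`!%:R != 0 :> rat by rewrite pnatr_eq0 -lt0n fact_gt0.
by rewrite /fps_cosh exprM sqrrN !expr1n; field; rewrite nz.
Qed.

Definition cosh_poly (n : nat) : {poly rat} :=
  \poly_(i < (2 * n).+1) fps_cosh i.

Lemma cosh_poly0 : cosh_poly 0 = 1.
Proof. by rewrite /cosh_poly poly_def big_ord1 expr0 -[RHS]scale1r. Qed.

Lemma cosh_polyS n :
  cosh_poly n.+1 =
  cosh_poly n + (2 * n.+1)`!%:R^-1 *: 'X^(2 * n.+1).
Proof.
rewrite -fps_cosh_even /cosh_poly !mulnS !add2n !poly_def.
by rewrite 2!big_ord_recr /= fps_cosh_odd scale0r addr0.
Qed.

Lemma factM2S n :
  (2 * n.+1)`! = ((2 * n.+1 - 1) * (2 * n.+1) * (2 * n)`!)%N.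
Proof. by rewrite mulnS add2n !factS subn1 /= mulnA [in LHS](mulnC (_.+2)). Qed.

Lemma sech_aS n :
  sech_a n.+1 = ((2 * n.+1 - 1) * (2 * n.+1))%N%:R%:P + 'X^2.
Proof. by []. Qed.

Lemma sech_bSS n :
  sech_b n.+2 = - (((2 * n.+1 - 1) * (2 * n.+1))%N%:R *: 'X^2).
Proof.
rewrite /sech_b /=; congr (- (_%:R *: _)); congr (_ * _)%N; lia.
Qed.

(** Two consecutive terms are carried for the two-step recurrence. The induction starts at index 1
    because b_1 = -x^2 is outside the general pattern. *)
Lemma sech_cf_num_rec n :
  cf_rec sech_a sech_b (1, sech_a 0) n.+1 =
  ((2 * n)`!%:R%:P, (2 * n.+1)`!%:R%:P).
Proof.
elim: n => [|n IHn].
  rewrite /= sech_aS /sech_a /sech_b /=; congr (_, _).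
  by rewrite !mulr1 addrK.
rewrite (cf_recS IHn); congr (_, _).
rewrite sech_aS sech_bSS (factM2S n.+1) natrM polyCM mulrDl.
by rewrite (factM2S n) natrM polyCM -mul_polyC; ring.
Qed.

Lemma sech_cf_den_rec n :
  cf_rec sech_a sech_b (0, 1) n.+1 =
  ((2 * n)`!%:R *: cosh_poly n, (2 * n.+1)`!%:R *: cosh_poly n.+1).
Proof.
have nz m : m`!%:R != 0 :> rat by rewrite pnatr_eq0 -lt0n fact_gt0.
have step m : (2 * m.+1)`!%:R *: cosh_poly m.+1 =
    (2 * m.+1)`!%:R *: cosh_poly m + 'X^(2 * m.+1).
  by rewrite cosh_polyS scalerDr scalerA divff // scale1r.
elim: n => [|n IHn].
  rewrite step cosh_poly0 /= sech_aS /sech_b /=; congr (_, _).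
    by rewrite scale1r.
  by rewrite mulr0 addr0 mulr1 alg_polyC.
rewrite (cf_recS IHn); congr (_, _).
have Xm : 'X^(2 * n.+2) = 'X^2 * 'X^(2 * n.+1) :> {poly rat}.
  by rewrite -exprD -mulnS.
rewrite (step n.+1) Xm.
(* Eliminating the power of x leaves an identity in two consecutive Taylor polynomials, which [ring]
   can check. *)
have -> : 'X^(2 * n.+1) = (2 * n.+1)`!%:R *: (cosh_poly n.+1 - cosh_poly n).
  by rewrite scalerBr step addrC addKr.
rewrite sech_aS sech_bSS (factM2S n.+1) (factM2S n) !natrM -!mul_polyC.
rewrite !polyCM; ring.
Qed.

Lemma sech_cf_num n : cf_num sech_a sech_b n = (2 * n)`!%:R%:P.
Proof.
case: n => [|n]; first by rewrite /cf_num /= polyC1.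
by rewrite /cf_num sech_cf_num_rec.
Qed.

Lemma sech_cf_den n :
  cf_den sech_a sech_b n = (2 * n)`!%:R *: cosh_poly n.
Proof.
case: n => [|n]; first by rewrite /cf_den /= cosh_poly0 scale1r.
by rewrite /cf_den sech_cf_den_rec.
Qed.

Theorem corollary5 :
  egf euler_number =1 fps_inv fps_cosh /\
  has_cf_expansion sech_a sech_b (egf euler_number).
Proof.
have nz m : m`!%:R != 0 :> rat by rewrite pnatr_eq0 -lt0n fact_gt0.
have egfE : egf euler_number =1 fps_inv fps_cosh.
  by move=> n; rewrite /egf /euler_number mulrC mulKf.
split=> // n.
have coshE i : (i <= 2 * n)%N -> fps_of_poly (cosh_poly n) i = fps_cosh i.
  by move=> le_i; rewrite /fps_of_poly coef_poly ltnS le_i.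
have cosh0 : fps_of_poly (cosh_poly n) 0 != 0 by rewrite coshE.
(* After cancelling (2n)!, the convergent is 1 / C_n. *)
exists (fps_inv (fps_of_poly (cosh_poly n))).
  rewrite sech_cf_num sech_cf_den; split=> [|k].
    rewrite scaler_eq0 negb_or nz; apply: contraNneq cosh0 => ->.
    by rewrite /fps_of_poly coef0.
  rewrite fps_mul_polyZ fps_mulC fps_mulVf // /fps_one /fps_of_poly coefC.
  by case: eqP; rewrite ?mulr1 ?mulr0.
move=> k lt_kn; rewrite egfE; apply: fps_inv_eqmod lt_kn => i lt_in.
(* Only i <= n is required here, and n <= 2n. *)
by apply: coshE; lia.
Qed.
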